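(* Consider the online algorithm $\mathrm{ALG}$ described in the context with parameters $\beta = 2$ and $\alpha = 1/2$. Its competitive ratio is $O(m^{\log_2 5.5}) = O(m^{2.46})$, where $2m$ is the number of requests in the input sequence. That is, there is an absolute constant $c$ such that for every metric space, every $m \ge 1$ and every input of $2m$ requests, the total cost of $\mathrm{ALG}$ (under any tie-breaking) is at most $c \cdot m^{\log_2 5.5}$ times the cost of an optimal offline solution.
   Context: Min-cost Perfect Matching with Delays (MPMD): there is a metric space $(\mathcal{X},\mathrm{dist})$ (distances between distinct points may be zero). The input is a sequence of $2m$ requests $(p_i,t_i)$, $p_i\in\mathcal{X}$, $t_1\le t_2\le\dots\le t_{2m}$, revealed online in order of arrival; $m$ is not known in advance. All requested points are assumed distinct, and a request is identified with its point $p$; its arrival time is $\mathrm{atime}(p)$. At any time $\tau$ an algorithm may match two requests $p,q$ that have already arrived and are not yet matched; this matching edge costs $\mathrm{dist}(p,q)+(\tau-\mathrm{atime}(p))+(\tau-\mathrm{atime}(q))$. All requests must eventually be matched; the cost of a solution is the sum of the costs of its matching edges. An offline optimal solution knows the whole input in advance. For $\tau\ge \mathrm{atime}(p)$ let $\mathrm{wait}_\tau(p)=\tau-\mathrm{atime}(p)$. Algorithm $\mathrm{ALG}$ with parameters $\alpha>0$, $\beta>1$: it matches two arrived, not yet matched requests $p,q$ at time $\tau$ as soon as both of the following hold: (budget sufficiency) $\alpha(\mathrm{wait}_\tau(p)+\mathrm{wait}_\tau(q))\ge \mathrm{dist}(p,q)$; (budget balance) $\mathrm{wait}_\tau(p)\le\beta\,\mathrm{wait}_\tau(q)$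 and $\mathrm{wait}_\tau(q)\le\beta\,\mathrm{wait}_\tau(p)$. If several pairs satisfy the conditions simultaneously, ties are broken arbitrarily and the pairs are processed in any order. *)

(* Defs.v *)
From HB Require Import structures.
From mathcomp Require Import all_boot all_order all_algebra.
From mathcomp Require Import all_classical all_reals all_analysis.

Set Implicit Arguments.
Unset Strict Implicit.
Unset Printing Implicit Defensive.

Import Order.TTheory GRing.Theory Num.Theory.

Local Open Scope ring_scope.

(* Distinct points may be at distance zero, so the library's metricType, whose
   distance separates points, is too restrictive here. *)
Record pmetric (R : realType) (X : Type) := PMetric {
  dist :> X -> X -> R ;
  dist_ge0 : forall x y, 0 <= dist x y ;
  distxx : forall x, dist x x = 0 ;
  dist_sym : forall x y, dist x y = dist y x ;
  dist_triangle : forall x y z, dist x z <= dist x y + dist y z }.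

(* Requests are named by their rank in the arrival order; as the requested
   points are distinct, this identifies a request with its point. *)
Record requests (R : realType) (X : Type) (n : nat) := Requests {
  point : 'I_n -> X ;
  atime : 'I_n -> R ;
  point_inj : injective point ;
  atime_homo : {homo atime : i j / (i <= j)%N >-> i <= j} }.

Definition arrived (R : realType) (X : Type) (n : nat) (I : requests R X n)
    (tau : R) (i : 'I_n) : bool :=
  atime I i <= tau.

Definition wait (R : realType) (X : Type) (n : nat) (I : requests R X n)
    (tau : R) (i : 'I_n) : R :=
  tau - atime I i.

(* A matching edge (p, q, tau): requests p and q are matched at time tau. *)
Notation edge R n := ('I_n * 'I_n * R)%type.

Definition endpoints (R : realType) (n : nat) (s : seq (edge R n)) : seq 'I_n :=
  flatten [seq [:: e.1.1; e.1.2] | e <- s].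

(* Every request belongs to at most one edge, and is matched only after its
   arrival; uniqueness also forces the two ends of an edge to differ. The order
   of s is irrelevant. *)
Definition schedule (R : realType) (X : Type) (n : nat) (I : requests R X n)
    (s : seq (edge R n)) : Prop :=
  uniq (endpoints s) /\
  forall p q tau, (p, q, tau) \in s -> arrived I tau p && arrived I tau q.

Definition solution (R : realType) (X : Type) (n : nat) (I : requests R X n)
    (s : seq (edge R n)) : Prop :=
  schedule I s /\ forall i : 'I_n, i \in endpoints s.

Definition cost (R : realType) (X : Type) (d : pmetric R X) (n : nat)
    (I : requests R X n) (s : seq (edge R n)) : R :=
  \sum_(e <- s) (d (point I e.1.1) (point I e.1.2)
                 + wait I e.2 e.1.1 + wait I e.2 e.1.2).

Definition optimal (R : realType) (X : Type) (d : pmetric R X) (n : nat)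
    (I : requests R X n) (s : seq (edge R n)) : Prop :=
  solution I s /\ forall s', solution I s' -> cost d I s <= cost d I s'.

Definition budget_sufficiency (R : realType) (alpha : R) (X : Type)
    (d : pmetric R X) (n : nat) (I : requests R X n) (tau : R) (p q : 'I_n)
    : bool :=
  d (point I p) (point I q) <= alpha * (wait I tau p + wait I tau q).

Definition budget_balance (R : realType) (beta : R) (X : Type) (n : nat)
    (I : requests R X n) (tau : R) (p q : 'I_n) : bool :=
  (wait I tau p <= beta * wait I tau q) && (wait I tau q <= beta * wait I tau p).

(* i has not been matched at any time up to and including tau *)
Definition unmatched (R : realType) (n : nat) (s : seq (edge R n)) (tau : R)
    (i : 'I_n) : bool :=
  i \notin endpoints [seq e <- s | e.2 <= tau].

(* s is the set of edges created by some run of ALG, for some tie-breaking.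
   Only pairs meeting both conditions are matched, and once ALG has acted at
   time tau no such pair is left. The latter is what "as soon as" means: a pair
   cannot meet both conditions at a time after which both ends remain
   unmatched. The edges created at one time tau thus form an arbitrary maximal
   matching of the pairs then meeting the conditions. That all requests end up
   matched is not assumed. *)
Definition ALG_run (R : realType) (alpha beta : R) (X : Type) (d : pmetric R X)
    (n : nat) (I : requests R X n) (s : seq (edge R n)) : Prop :=
  [/\ schedule I s,
      forall p q tau, (p, q, tau) \in s ->
        budget_sufficiency alpha d I tau p q && budget_balance beta I tau p q
    & forall p q tau, p != q ->
        arrived I tau p -> arrived I tau q ->
        unmatched s tau p -> unmatched s tau q ->
        ~~ (budget_sufficiency alpha d I tau p q
            && budget_balance beta I tau p q)].

(* Main.v *)
Require Import Defs.
From HB Require Import structures.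
From mathcomp Require Import all_boot all_order all_algebra.
From mathcomp Require Import all_classical all_reals all_analysis.
From mathcomp Require Import lra.

Set Implicit Arguments.
Unset Strict Implicit.
Unset Printing Implicit Defensive.

Import Order.TTheory GRing.Theory Num.Theory.

Local Open Scope ring_scope.

(** Measure requests by D(p, q) = dist(p, q) + 2 |atime p - atime q|; a solution
    costs at least half the D-length of its matching. If ALG matches p with q at
    time tau and w is the smaller of their two waiting times, then balance and
    sufficiency give D(p, q) <= 7/2 w and an edge cost of at most 9/2 w, whereas
    w <= D(p, r) for every r not matched before tau, since otherwise p and r would
    have met both conditions earlier. Go through the edges of ALG by increasing
    time, starting from the optimal matching; on processing (p, q), with partners
    p' and q', replace the pairs (p, p') and (q, q') by (p', q'), whose D-length is
    at most x + y + 7/2 min(x, y) for x = D(p, p'), y = D(q, q'). Hence a pair made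
    from k optimal edges of total length S has length at most S k^delta, where
    2^(1 + delta) = 2 + 7/2. So each of the m edges has w <= 2 OPT m^delta, and
    m^(1 + delta) = m^(log_2 5.5). *)

(** * Merging inequality and bounded pairings *)

(** With [x = a * k ^ dl] and [y = b * l ^ dl] the right side is [x * u + y * v], where [u, v >= 1],
    and [(k + l)^2 >= 4 * k * l] yields [u + v >= 2 * 2 ^ dl >= 2 + g]. For [x <= y], rewrite it as
    [x * (u + v) + (y - x) * v]; the other case is symmetric. *)
Lemma powR_merge (R : realType) (g dl : R) (g0 : 0 <= g) (dl0 : 0 <= dl)
    (gdl : 2 + g <= 2 * 2 `^ dl) (a b k l : R) :
  0 <= a -> 0 <= b -> 0 < k -> 0 < l ->
  a * k `^ dl + b * l `^ dl + g * Num.min (a * k `^ dl) (b * l `^ dl)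
    <= (a + b) * (k + l) `^ dl.
Proof.
move=> a0 b0 k0 l0.
have kl0 : 0 < k + l by rewrite addr_gt0.
pose u := ((k + l) / k) `^ dl; pose v := ((k + l) / l) `^ dl.
have uE : (k + l) `^ dl = k `^ dl * u.
  by rewrite /u -powRM ?ltW ?divr_gt0 // mulrC divfK // gt_eqF.
have vE : (k + l) `^ dl = l `^ dl * v.
  by rewrite /v -powRM ?ltW ?divr_gt0 // mulrC divfK // gt_eqF.
have one : 1 `^ dl = 1 :> R by rewrite powR1.
have u1 : 1 <= u.
  rewrite -one /u ge0_ler_powR ?nnegrE ?divr_ge0 ?(ltW kl0) ?(ltW k0) ?(ltW l0) //.
  by rewrite ler_pdivlMr // mul1r lerDl ltW.
have v1 : 1 <= v.
  rewrite -one /v ge0_ler_powR ?nnegrE ?divr_ge0 ?(ltW kl0) ?(ltW k0) ?(ltW l0) //.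
  by rewrite ler_pdivlMr // mul1r lerDr ltW.
have uv : 2 `^ dl * 2 `^ dl <= u * v.
  rewrite /u /v -!powRM ?divr_ge0 ?(ltW kl0) ?(ltW k0) ?(ltW l0) //.
  rewrite ge0_ler_powR ?nnegrE ?mulr_ge0 ?invr_ge0 ?(ltW kl0) ?(ltW k0) ?(ltW l0) //.
  rewrite mulf_div ler_pdivlMr ?mulr_gt0 //.
  have := sqr_ge0 (k - l); nra.
have p0 : 0 < 2 `^ dl :> R by rewrite powR_gt0.
(* AM-GM *)
have uvD : 2 * 2 `^ dl <= u + v.
  rewrite -(@ler_pXn2r _ 2) ?nnegrE; [|by []|nra|nra].
  have := sqr_ge0 (u - v); nra.
rewrite mulrDl {1}uE vE !mulrA.
set x := a * _; set y := b * _.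
have x0 : 0 <= x by rewrite mulr_ge0 ?powR_ge0.
have y0 : 0 <= y by rewrite mulr_ge0 ?powR_ge0.
have [xy|yx] := leP x y.
  have h1 := ler_wpM2l x0 (le_trans gdl uvD).
  have xy' : 0 <= y - x by rewrite subr_ge0.
  have h2 := ler_wpM2l xy' v1.
  nra.
have h1 := ler_wpM2l y0 (le_trans gdl uvD).
have xy' : 0 <= x - y by rewrite subr_ge0 ltW.
have h2 := ler_wpM2l xy' u1.
nra.
Qed.

(* The elements of A can be paired so that the i-th pair is at distance at most
   S_i * K_i ^ dl, where S and K are the sums of the S_i and of the K_i. *)
Inductive bounded_pairing (R : realType) (T : eqType) (D : pmetric R T)
    (dl : R) : seq T -> R -> R -> Prop :=
| pairing_nil : bounded_pairing D dl [::] 0 0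
| pairing_cons p q A S K S' K' : 0 <= S -> 1 <= K -> D p q <= S * K `^ dl ->
    bounded_pairing D dl A S' K' ->
    bounded_pairing D dl [:: p, q & A] (S + S') (K + K')
| pairing_perm A B S K : perm_eq A B ->
    bounded_pairing D dl A S K -> bounded_pairing D dl B S K.

Lemma bounded_pairing_ge0 (R : realType) (T : eqType) (D : pmetric R T)
    (dl : R) (A : seq T) (S K : R) :
  bounded_pairing D dl A S K -> 0 <= S /\ 0 <= K.
Proof.
elim=> // p q {}A {}S {}K S' K' S0 K1 _ _ [S'0 K'0].
by rewrite !addr_ge0 // (le_trans ler01).
Qed.

(** Permutations rule out plain inversion, so the pair holding [x] is found by induction; symmetry
    of [D] lets [x] come first. *)
Lemma bounded_pairing_extract (R : realType) (T : eqType) (D : pmetric R T)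
    (dl : R) (A : seq T) (S K : R) (x : T) :
  bounded_pairing D dl A S K -> x \in A ->
  exists y A' S1 K1 S' K',
    [/\ perm_eq A [:: x, y & A'], bounded_pairing D dl A' S' K',
        S = S1 + S' /\ K = K1 + K', 0 <= S1 /\ 1 <= K1
      & D x y <= S1 * K1 `^ dl].
Proof.
elim=> {A S K} [//|p q A S K S' K' S0 K1 Dpq pA IH|A B S K AB pA IH].
- rewrite !inE => /or3P[/eqP->|/eqP->|xA].
  + by exists q, A, S, K, S', K'; split.
  + exists p, A, S, K, S', K'; split; rewrite // 1?dist_sym //.
    by rewrite (perm_catCA [:: p] [:: q] A) /= perm_refl.
  + have [y [A' [S1 [K2 [S2 [K3 [pA' bA' [-> ->] [S10 K21] Dxy]]]]]]] := IH xA.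
    exists y, [:: p, q & A'], S1, K2, (S + S2), (K + K3); split.
    * rewrite perm_sym (perm_catCA [:: x; y] [:: p; q] A') /= !perm_cons.
      by rewrite perm_sym.
    * exact: pairing_cons.
    * by rewrite !(addrCA S) !(addrCA K).
    * by [].
    * by [].
- rewrite -(perm_mem AB) => /IH[y [A' [S1 [K1 [S' [K' [pA' ? ? ? ?]]]]]]].
  exists y, A', S1, K1, S', K'; split => //.
  by rewrite (perm_trans _ pA') // perm_sym.
Qed.

Lemma mul_powR_le (R : realType) (dl S K S' K' : R) : 0 <= dl ->
  0 <= S -> 0 <= K -> S <= S' -> K <= K' -> S * K `^ dl <= S' * K' `^ dl.
Proof.
move=> dl0 S0 K0 SS KK.
by rewrite ler_pM ?powR_ge0 // ge0_ler_powR // nnegrE // (le_trans K0).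
Qed.

(** * Greedy processing of weighted edges *)

Definition ends (R : realType) (n : nat) (e : edge R n) : seq 'I_n :=
  [:: e.1.1; e.1.2].

Lemma endpoints_cons (R : realType) (n : nat) (e : edge R n) s :
  endpoints (e :: s) = [:: e.1.1, e.1.2 & endpoints s].
Proof. by []. Qed.

Lemma mem_endpoints (R : realType) (n : nat) (s : seq (edge R n)) (p : 'I_n) :
  p \in endpoints s -> exists2 e, e \in s & p \in ends e.
Proof. by case/flatten_mapP => e es pe; exists e. Qed.

Lemma ends_endpoints (R : realType) (n : nat) (s : seq (edge R n)) e (p : 'I_n) :
  e \in s -> p \in ends e -> p \in endpoints s.
Proof. by move=> es pe; apply/flatten_mapP; exists e. Qed.

(** Induction on [s] with the pairing varying: after an edge is processed the totals of the new
    pairing do not exceed [S] and [K], so every single weight is at most [S * K ^ dl]. *)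
Lemma greedy_weight (R : realType) (n : nat) (D : pmetric R 'I_n)
    (g dl : R) (g0 : 0 <= g) (dl0 : 0 <= dl) (gdl : 2 + g <= 2 * 2 `^ dl)
    (w : edge R n -> R) (s : seq (edge R n)) (S K : R) :
  sorted (fun e f => e.2 <= f.2) s -> uniq (endpoints s) ->
  {in s, forall e, D e.1.1 e.1.2 <= g * w e} ->
  {in s &, forall e f, e.2 <= f.2 -> forall p q, p \in ends e -> q \in ends f ->
    p != q -> w e <= D p q} ->
  bounded_pairing D dl (endpoints s) S K ->
  \sum_(e <- s) w e <= (size s)%:R * (S * K `^ dl).
Proof.
elim: s S K => [|e s IH] S K; first by rewrite big_nil mul0r.
move=> srt; rewrite endpoints_cons big_cons /= => /and3P[].
rewrite inE negb_or => /andP[pq ps] qs us Dw wD bp.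
have /allP les : all (fun f : edge R n => e.2 <= f.2) s.
  by apply: order_path_min srt => x y z; exact: le_trans.
have {}IH S' K' : bounded_pairing D dl (endpoints s) S' K' ->
    \sum_(e <- s) w e <= (size s)%:R * (S' * K' `^ dl).
  apply: IH => //.
  - exact: path_sorted srt.
  - by move=> f fs; apply: Dw; rewrite inE fs orbT.
  - by move=> f h fs hs; apply: wD; rewrite inE ?fs ?hs orbT.
have wr p r : p \in ends e -> p \notin endpoints s -> r \in endpoints s ->
    w e <= D p r.
  move=> pe pns rs; have [f fs rf] := mem_endpoints rs.
  apply: (wD e f) => //; rewrite ?inE ?eqxx ?fs ?orbT ?les //.
  by apply: contraNneq pns => ->.
have [S0 K0] := bounded_pairing_ge0 bp.
suff [weSK sSK] : w e <= S * K `^ dl /\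
    \sum_(e <- s) w e <= (size s)%:R * (S * K `^ dl).
  by rewrite -natr1 mulrDl mul1r addrC lerD.
move: e pq ps qs Dw wD bp wr {srt les} => [[p q] t] /= pq ps qs Dw wD bp wr.
have [p1 [A1 [S1 [K1 [S' [K' [pA1 bA1 [SE KE] [S10 K11] Dp]]]]]]] :=
  bounded_pairing_extract bp (mem_head p _).
have [S'0 K'0] := bounded_pairing_ge0 bA1.
rewrite perm_cons in pA1.
have K10 : 0 <= K1 by rewrite (le_trans ler01).
have pe : p \in ends (p, q, t) by rewrite inE eqxx.
have qe : q \in ends (p, q, t) by rewrite !inE eqxx orbT.
have [p1q|p1q] := eqVneq p1 q.
  rewrite p1q perm_cons in pA1; subst p1; split.
    (* [p] and [q] are paired with each other; the weight hypothesis is used with [e = f]. *)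
    have pqe : w (p, q, t) <= D p q.
      by apply: (wD (p, q, t) (p, q, t)); rewrite ?mem_head.
    by rewrite (le_trans pqe) // (le_trans Dp) // mul_powR_le // ?SE ?KE ?lerDl.
  rewrite perm_sym in pA1.
  apply: le_trans (IH _ _ (pairing_perm pA1 bA1)) _.
  by rewrite ler_wpM2l // mul_powR_le // ?SE ?KE ?lerDr.
have qA1 : q \in A1.
  have : q \in p1 :: A1 by rewrite -(perm_mem pA1) inE eqxx.
  by rewrite inE eq_sym (negPf p1q).
have [q1 [A2 [S2 [K2 [S3 [K3 [pA2 bA2 [S'E K'E] [S20 K21] Dq]]]]]]] :=
  bounded_pairing_extract bA1 qA1.
have [S30 K30] := bounded_pairing_ge0 bA2.
have pE : perm_eq [:: p1, q1 & A2] (endpoints s).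
  rewrite perm_sym -(perm_cons q) (perm_trans pA1) //.
  rewrite -(perm_cons p1) in pA2; rewrite (perm_trans pA2) //.
  by rewrite (perm_catCA [:: p1] [:: q] (q1 :: A2)) perm_refl.
have K1gt0 : 0 < K1 by rewrite (lt_le_trans ltr01).
have K2gt0 : 0 < K2 by rewrite (lt_le_trans ltr01).
have wp1 : w (p, q, t) <= D p p1 by apply: wr => //; rewrite -(perm_mem pE) inE eqxx.
have wq1 : w (p, q, t) <= D q q1.
  by apply: wr => //; rewrite -(perm_mem pE) !inE eqxx orbT.
have SKle : S1 * K1 `^ dl <= S * K `^ dl by rewrite mul_powR_le // ?SE ?KE ?lerDl.
split; first by rewrite (le_trans wp1) // (le_trans Dp).
(* The new pair [(p1, q1)] inherits [S1 + S2] and [K1 + K2], so both totals stay the same. *)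
apply: IH; rewrite SE KE S'E K'E !addrA.
apply: (pairing_perm pE); apply: pairing_cons => //.
- by rewrite addr_ge0.
- lra.
(* Triangle inequality along [p1], [p], [q], [q1]: the middle leg is at most [g] times the smaller
   of the bounds on the outer legs. *)
- apply: le_trans (powR_merge g0 dl0 gdl S10 S20 K1gt0 K2gt0).
  have Dpq : D p q <= g * w (p, q, t) by apply: (Dw (p, q, t)); rewrite inE eqxx.
  have wmin : w (p, q, t) <= Num.min (S1 * K1 `^ dl) (S2 * K2 `^ dl).
    by rewrite le_min (le_trans wp1) // (le_trans wq1).
  have := ler_wpM2l g0 wmin.
  have := dist_triangle D p1 p q1; have := dist_triangle D p q q1.
  rewrite (dist_sym D p1 p); lra.
Qed.

(** * The space-time pseudometric *)

(* With weight 1 on time gaps only [wait p <= 2 * D p r] would hold in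
   [ALG_wait_le], and the exponent would get worse. *)
Definition spacetime_fun (R : realType) (X : Type) (d : pmetric R X) (n : nat)
    (I : requests R X n) (p q : 'I_n) : R :=
  d (Defs.point I p) (Defs.point I q) + 2 * `|atime I p - atime I q|.

Lemma spacetime_subproof (R : realType) (X : Type) (d : pmetric R X) (n : nat)
    (I : requests R X n) (D := spacetime_fun d I) :
  [/\ forall p q, 0 <= D p q, forall p, D p p = 0, forall p q, D p q = D q p
    & forall p q r, D p r <= D p q + D q r].
Proof.
rewrite /D /spacetime_fun; split.
- by move=> p q; rewrite addr_ge0 ?dist_ge0 ?mulr_ge0.
- by move=> p; rewrite distxx subrr normr0 mulr0 addr0.
- by move=> p q; rewrite dist_sym distrC.
- move=> p q r; have := dist_triangle d (Defs.point I p) (Defs.point I q) (Defs.point I r).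
  have := ler_distD (atime I q) (atime I p) (atime I r); lra.
Qed.

Definition spacetime (R : realType) (X : Type) (d : pmetric R X) (n : nat)
    (I : requests R X n) : pmetric R 'I_n :=
  let: And4 h1 h2 h3 h4 := spacetime_subproof d I in PMetric h1 h2 h3 h4.

Lemma spacetimeE (R : realType) (X : Type) (d : pmetric R X) (n : nat)
    (I : requests R X n) (p q : 'I_n) :
  spacetime d I p q = d (Defs.point I p) (Defs.point I q) + 2 * `|atime I p - atime I q|.
Proof. by rewrite /spacetime; case: spacetime_subproof. Qed.

(** * Edges of solutions and behaviour of ALG *)

Lemma endpoints_inj (R : realType) (n : nat) (s : seq (edge R n)) (e f : edge R n)
    (p : 'I_n) :
  uniq (endpoints s) -> e \in s -> f \in s -> p \in ends e -> p \in ends f ->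
  e = f.
Proof.
elim: s => // h s IH; rewrite endpoints_cons /= inE negb_or.
move=> /and3P[/andP[_ n1] n2 us]; rewrite (in_cons h s e) (in_cons h s f).
have nh : p \in ends h -> p \notin endpoints s by rewrite !inE => /orP[]/eqP->.
move=> /predU1P[->|es] /predU1P[->|fs] // pe pf.
- by have := nh pe; rewrite (ends_endpoints fs).
- by have := nh pf; rewrite (ends_endpoints es).
- exact: IH.
Qed.

Lemma size_endpoints (R : realType) (n : nat) (s : seq (edge R n)) :
  size (endpoints s) = (size s).*2.
Proof. by elim: s => //= e s IH; rewrite doubleS -IH. Qed.

Lemma solution_size (R : realType) (X : Type) (m : nat) (I : requests R X m.*2)
    (s : seq (edge R m.*2)) : solution I s -> size s = m.
Proof.
move=> [[us _] alls]; apply: double_inj; rewrite -size_endpoints.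
rewrite -(card_uniqP us) -[RHS]card_ord; apply: eq_card => i.
by rewrite alls inE.
Qed.

Lemma solution_perm (R : realType) (X : Type) (n : nat) (I : requests R X n)
    (s t : seq (edge R n)) : solution I s -> solution I t ->
  perm_eq (endpoints s) (endpoints t).
Proof.
by move=> [[us _] hs] [[ut _] ht]; apply: uniq_perm => // i; rewrite hs ht.
Qed.

(** Once [p] has waited longer than [D], the wait of [q] differs from it by at most [D / 2]: the
    waits are balanced within a factor 2, and half their sum reaches the distance. So the pair could
    not have stayed unmatched. *)
Lemma ALG_wait_le (R : realType) (X : Type) (d : pmetric R X) (n : nat)
    (I : requests R X n) (s : seq (edge R n)) : ALG_run (1 / 2) 2 d I s ->
  {in s &, forall e f, e.2 <= f.2 -> forall p q, p \in ends e -> q \in ends f ->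
    p != q -> wait I e.2 p <= spacetime d I p q}.
Proof.
move=> [[us _] _ noc] e f es fs ef p q pe qf pq; rewrite spacetimeE leNgt.
set D := _ + _; apply/negP => Dlt.
(* Midway between the waits [D] and [wait I e.2 p]: strictly before [e.2], so both requests are
   unmatched, yet [p] has waited more than [D]. *)
pose tau := atime I p + (D + wait I e.2 p) / 2.
have taue : tau < e.2 by rewrite /tau; move: Dlt; rewrite /wait; lra.
have unm h r : h \in s -> r \in ends h -> e.2 <= h.2 -> unmatched s tau r.
  move=> hs rh eh; apply/negP => /mem_endpoints[k].
  rewrite mem_filter => /andP[ktau ks] rk.
  have kh := endpoints_inj us ks hs rk rh; subst k.
  by have := lt_le_trans taue eh; rewrite ltNge ktau.
have d0 := dist_ge0 d (Defs.point I p) (Defs.point I q).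
have := ler_norm (atime I p - atime I q).
have := ler_norm (- (atime I p - atime I q)); rewrite normrN.
move=> n1 n2.
move: Dlt; rewrite /D => Dlt.
have : ~~ (budget_sufficiency (1 / 2) d I tau p q && budget_balance 2 I tau p q).
  apply: noc => //.
  - rewrite /arrived /tau /D; lra.
  - rewrite /arrived /tau /D; lra.
  - exact: unm es pe _.
  - exact: unm fs qf ef.
rewrite /budget_sufficiency /budget_balance /tau /D.
move: Dlt; rewrite /wait => Dlt.
move=> /negP; apply; apply/and3P; split; lra.
Qed.

(** By parity unmatched requests come at least in twos, and any two of them meet both conditions at
    a late enough time. *)
Lemma ALG_all_matched (R : realType) (X : Type) (d : pmetric R X) (m : nat)
    (I : requests R X m.*2) (s : seq (edge R m.*2)) :
  ALG_run (1 / 2) 2 d I s -> solution I s.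
Proof.
move=> [sch _ noc]; split=> // i; apply/negPn/negP => nis.
have us := sch.1.
have [j js] : exists2 j, j \notin endpoints s & j != i.
  apply/exists2P; apply: contrapT => nj.
  have : #|'I_m.*2| = (size s).*2.+1.
    rewrite -size_endpoints -[RHS]/(size (i :: endpoints s)).
    have /card_uniqP <- : uniq (i :: endpoints s) by rewrite /= nis us.
    apply: eq_card => j; rewrite inE /= inE; apply/esym/negPn/negP.
    rewrite negb_or => /andP[ji js]; apply: nj; exists j; split => //.
  by rewrite card_ord => /(congr1 odd); rewrite /= !odd_double.
move=> ji.
pose dij := d (Defs.point I i) (Defs.point I j).
have d0 : 0 <= dij := dist_ge0 d _ _.
(* Balance asks for [tau] at least [2 * atime I j - atime I i] and its mirror image, sufficiency for
   at least [dij] plus the mean arrival time. *)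
pose tau := dij + 2 * `|atime I i| + 2 * `|atime I j|
            + `|atime I i| + `|atime I j|.
have n1 := ler_norm (atime I i); have n2 := ler_norm (atime I j).
have := ler_norm (- atime I i); have := ler_norm (- atime I j).
rewrite !normrN => n3 n4.
have unm k : k \notin endpoints s -> unmatched s tau k.
  apply: contraNN => /mem_endpoints[e]; rewrite mem_filter => /andP[_ es] ke.
  exact: ends_endpoints es ke.
have : ~~ (budget_sufficiency (1 / 2) d I tau i j && budget_balance 2 I tau i j).
  apply: noc; rewrite ?unm // 1?eq_sym //; rewrite /arrived /tau; lra.
move=> /negP; apply; rewrite /budget_sufficiency /budget_balance -/dij /wait /tau.
by apply/and3P; split; lra.
Qed.

(** Each edge is its own pair, with [K = 1]. The factor 2 absorbs the weight 2 on the time gap,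
    which is at most the sum of the two waits. *)
Lemma opt_pairing (R : realType) (X : Type) (d : pmetric R X) (n : nat)
    (I : requests R X n) (dl : R) (s : seq (edge R n)) :
  {in s, forall e, arrived I e.2 e.1.1 && arrived I e.2 e.1.2} ->
  bounded_pairing (spacetime d I) dl (endpoints s) (2 * cost d I s) (size s)%:R.
Proof.
rewrite /cost; elim: s => [|e s IH] arr.
  by rewrite big_nil mulr0; apply: pairing_nil.
rewrite big_cons mulrDr /= -(nat1r (size s)).
have /andP[] := arr e (mem_head _ _); rewrite /arrived => a1 a2.
rewrite endpoints_cons; have d0 := dist_ge0 d (Defs.point I e.1.1) (Defs.point I e.1.2).
apply: pairing_cons => //.
- by rewrite /wait; lra.
- rewrite powR1 mulr1 spacetimeE /wait.
  have : `|atime I e.1.1 - atime I e.1.2| <=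
      (e.2 - atime I e.1.1) + (e.2 - atime I e.1.2).
    by rewrite ler_norml; apply/andP; split; lra.
  by lra.
- by apply: IH => f fs; apply: arr; rewrite inE fs orbT.
Qed.

(** * The numerical exponent and the final bound *)

Lemma ln_ratio_le (R : realType) : ln (11 / 2) / ln 2 <= 246 / 100 :> R.
Proof.
have l2 : 0 < ln 2 :> R by rewrite ln_gt0 //; lra.
rewrite ler_pdivrMr //.
suff : ln ((11 / 2) ^+ 50) <= ln (2 ^+ 123) :> R.
  by rewrite !lnXn; [lra|lra|lra].
have e0 : 0 < 11 / 2 :> R by lra.
rewrite ler_ln ?posrE ?exprn_gt0 //.
(* Fifth powers keep the numerals small: [5.5^10 <= 1.51 * 2^24] and [1.51^5 <= 2^3]. *)
have -> : (11 / 2) ^+ 50 = ((11 / 2) ^+ 10) ^+ 5 :> R by rewrite -exprM.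
have -> : 2 ^+ 123 = (2 ^+ 24) ^+ 5 * 2 ^+ 3 :> R by rewrite -exprM -exprD.
have h : (11 / 2) ^+ 10 <= 2 ^+ 24 * (151 / 100) :> R by lra.
apply: (@le_trans _ _ ((2 ^+ 24 * (151 / 100)) ^+ 5)).
  by rewrite ler_pXn2r // nnegrE; rewrite ?exprn_ge0 ?mulr_ge0 ?exprn_ge0 //; lra.
by rewrite exprMn ler_wpM2l ?exprn_ge0 //; lra.
Qed.

Theorem mainTheorem1 (R : realType) :
  (exists c : R, 0 < c /\
    forall (X : Type) (d : pmetric R X) (m : nat) (I : requests R X m.*2)
           (s opt : seq (edge R m.*2)),
      (1 <= m)%N ->
      ALG_run (1 / 2) 2 d I s ->
      optimal d I opt ->
      solution I s /\
      cost d I s <= c * (m%:R `^ (ln (11 / 2) / ln 2)) * cost d I opt) /\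
  (exists c : R, 0 < c /\
    forall m : nat, (1 <= m)%N ->
      m%:R `^ (ln (11 / 2) / ln 2) <= c * m%:R `^ (246 / 100) :> R).
Proof.
split; last first.
  exists 1; split=> // m m1; rewrite mul1r ler_powR ?ler1n //.
  exact: ln_ratio_le.
(* 9 is [9 / 2], the edge cost per unit of [w], times 2 from [opt_pairing]. *)
exists 9; split=> // X d m I s opt m1 run [opts _].
have sols := ALG_all_matched run; split=> //.
have l2 : 0 < ln 2 :> R by rewrite ln_gt0 //; lra.
set ex := ln _ / ln _.
(* The missing factor [m] is the number of edges of [s]. *)
pose dl := ex - 1.
have ex1 : 2 `^ ex = 11 / 2.
  rewrite /powR gt_eqF // divfK ?gt_eqF // lnK // posrE; lra.
have dl0 : 0 <= dl.
  rewrite subr_ge0 /ex ler_pdivlMr // mul1r ler_ln ?posrE; lra.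
have exE (a : R) : 0 < a -> a `^ ex = a * a `^ dl.
  move=> a0; have exE : ex = 1 + dl by rewrite addrC subrK.
  by rewrite exE powRD ?powRr1 ?(ltW a0) // (gt_eqF a0) implybT.
have twodl : 2 + 7 / 2 <= 2 * 2 `^ dl :> R by rewrite -exE // ex1; lra.
pose le2 (e f : edge R m.*2) := e.2 <= f.2.
pose s' := sort le2 s.
have ss' : perm_eq s' s by rewrite (permEl (perm_sort le2 s)).
have sE : perm_eq (endpoints s') (endpoints s) by apply: perm_flatten; apply: perm_map.
have srt : sorted le2 s' by apply: sort_sorted => e f; rewrite /le2 le_total.
pose w (e : edge R m.*2) := Num.min (wait I e.2 e.1.1) (wait I e.2 e.1.2).
have ineqs e : e \in s -> let wp := wait I e.2 e.1.1 in
    let wq := wait I e.2 e.1.2 in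
    [/\ d (Defs.point I e.1.1) (Defs.point I e.1.2) <= 1 / 2 * (wp + wq),
        wp + wq <= 3 * w e, w e <= wp & w e <= wq].
  move: e => [[p q] t] es /=; have [_ cond _] := run.
  have := cond _ _ _ es; rewrite /budget_sufficiency /budget_balance /w /=.
  move=> /and3P[h1 h2 h3].
  have [[_ arr] _] := sols.
  have /andP[] := arr _ _ _ es; rewrite /arrived -(subr_ge0 (atime I p)) -(subr_ge0 (atime I q)).
  rewrite -/(wait I t p) -/(wait I t q) => wp0 wq0; split=> //.
  - by case: (leP (wait I t p) (wait I t q)) => _; lra.
  - by rewrite ge_min lexx.
  - by rewrite ge_min lexx orbT.
have g0 : 0 <= 7 / 2 :> R by lra.
have := @greedy_weight R _ (spacetime d I) _ _ g0 dl0 twodl w s'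
  (2 * cost d I opt) m%:R srt.
have -> : size s' = m by rewrite size_sort (solution_size sols).
rewrite (perm_uniq sE) (perm_big s) //= => greedy.
have {}greedy : \sum_(e <- s) w e <= m%:R * (2 * cost d I opt * m%:R `^ dl).
  apply: greedy.
  - by case: sols => [[]].
  (* The distance is at most [3 / 2 * w e]; the time gap is the difference of the waits, at most
     [w e], and counts twice. Together [7 / 2]. *)
  - move=> e; rewrite (perm_mem ss') => /ineqs /= [h1 h2 h3 h4].
    rewrite spacetimeE; move: h1 h2 h3 h4; rewrite /wait => h1 h2 h3 h4.
    by case: (ler0P (atime I e.1.1 - atime I e.1.2)) => _; lra.
  - move=> e f; rewrite !(perm_mem ss') => es fs ef p q pe qf pq.
    apply: le_trans (ALG_wait_le run es fs ef pe qf pq).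
    by move: pe; rewrite !inE => /orP[]/eqP->; rewrite ge_min lexx ?orbT.
  - have := @opt_pairing R X d _ I dl opt; rewrite (solution_size opts) => pr.
    apply: (@pairing_perm _ _ _ _ (endpoints opt)).
      by rewrite perm_sym (perm_trans sE) // (solution_perm sols opts).
    apply: pr => -[[p q] t] es; have [[_ arr] _] := opts; exact: arr es.
(* Distance at most [3 / 2 * w e] plus waits at most [3 * w e]. *)
have : cost d I s <= 9 / 2 * \sum_(e <- s) w e.
  rewrite mulr_sumr /cost big_seq [leRHS]big_seq ler_sum // => e /ineqs /=.
  by move=> [h1 h2 h3 h4]; lra.
move=> /le_trans; apply.
rewrite exE ?ltr0n //; move: greedy; set a := m%:R; set b := a `^ dl; set c := cost d I opt.
by move=> greedy; lra.
Qed.
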